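(* Let $\alpha>1$, let $\mathcal{Z}$ be either $\mathbb{R}$ or $\mathbb{Z}$, let $s\in\mathcal{Z}$ with $s>0$, and let $\mathcal{S}=[-s,s]\cap\mathcal{Z}$. Let $c:\mathcal{Z}\to[0,\infty)$ be a (measurable) symmetric cost function, i.e. $c(-z)=c(z)$ for all $z\in\mathcal{Z}$, and let $C>0$. For $P\in\mathcal{P}(\mathcal{Z})$ put $$g_\alpha(P,t)=\mathbb{E}_{P}\left[\left(\frac{P}{T_tP}\right)^{\alpha-1}\right],\qquad g_\alpha(P)=\max_{t\in\mathcal{S}}g_\alpha(P,t).$$ Then: (i) The function $P\mapsto g_\alpha(P)$ is convex on $\mathcal{P}(\mathcal{Z})$ (as a function with values in $(-\infty,\infty]$). (ii) To solve the optimization problem $$\underset{P\in\mathcal{P}(\mathcal{Z})}{\text{minimize}}\ \max_{t\in\mathcal{S}}D_\alpha(P\,\|\,T_tP)\quad\text{subject to}\quad\mathbb{E}_{Z\sim P}[c(Z)]\le C,$$ it suffices to restrict the search to symmetric distributions in $\mathcal{P}(\mathcal{Z})$; that is, the optimal value of the problem is unchanged when the additional constraint that $P$ be symmetric is imposed, and if the problem has a minimizer then it has a symmetric minimizer.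
   Context: $\mathcal{P}(\mathcal{Z})$ denotes the set of probability distributions on $\mathcal{Z}$ (Borel probability measures when $\mathcal{Z}=\mathbb{R}$, probability mass functions when $\mathcal{Z}=\mathbb{Z}$). For $P\in\mathcal{P}(\mathcal{Z})$ and $t\in\mathcal{Z}$, $T_tP$ is $P$ shifted by $t$, i.e. the law of $Z+t$ when $Z\sim P$; in terms of densities or mass functions, $(T_tf)(x)=f(x-t)$. A distribution $P$ is symmetric if it equals the law of $-Z$ when $Z\sim P$. For $\alpha>1$ the Rényi divergence of order $\alpha$ is $$D_\alpha(P\|Q)=\frac{1}{\alpha-1}\log\mathbb{E}_{P}\left[\left(\frac{P(X)}{Q(X)}\right)^{\alpha-1}\right],$$ where $P/Q$ is the Radon–Nikodym derivative $dP/dQ$, and where the expectation (hence also $D_\alpha$) is $+\infty$ when $P$ is not absolutely continuous with respect to $Q$. Thus $g_\alpha(P,t)$ is the quantity inside the logarithm of $D_\alpha(P\|T_tP)$. The maximum over $t\in\mathcal{S}$ is understood as a supremum with values in $(-\infty,\infty]$ if it is not attained. *)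

(* Defs.v *)
From HB Require Import structures.
From mathcomp Require Import all_boot all_order all_algebra.
From mathcomp Require Import all_classical all_reals all_analysis measurable_realfun.

Set Implicit Arguments.
Unset Strict Implicit.
Unset Printing Implicit Defensive.

Import Order.TTheory GRing.Theory Num.Theory.

Local Open Scope classical_set_scope.
Local Open Scope ring_scope.

(* With this sigma-algebra, probability int R is the type of probability mass
   functions on the integers (P is determined by the values P [set k]), and
   'd P '/d Q is the ratio of the mass functions, Q-almost everywhere. *)
HB.instance Definition _ := isPointed.Build int 0.
HB.instance Definition _ := @isMeasurable.Build default_measure_display
  int discrete_measurable discrete_measurable0
  discrete_measurableC discrete_measurableU.

Section translations.
Variable R : realType.

Definition translateR (t : R) : R -> R := fun z => z + t.
Definition reflectR : R -> R := fun z => - z.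

Let measurable_translateR t : measurable_fun setT (translateR t).
Proof. by apply: measurable_funD. Qed.
HB.instance Definition _ t := isMeasurableFun.Build _ _ _ _ (translateR t)
  (measurable_translateR t).

Let measurable_reflectR : measurable_fun setT reflectR.
Proof. exact: oppr_measurable. Qed.
HB.instance Definition _ := isMeasurableFun.Build _ _ _ _ reflectR
  measurable_reflectR.

Definition translateZ (t : int) : int -> int := fun z => z + t.
Definition reflectZ : int -> int := fun z => - z.

Let measurable_translateZ t : measurable_fun setT (translateZ t).
Proof. by []. Qed.
HB.instance Definition _ t := isMeasurableFun.Build _ _ _ _ (translateZ t)
  (measurable_translateZ t).

Let measurable_reflectZ : measurable_fun setT reflectZ.
Proof. by []. Qed.
HB.instance Definition _ := isMeasurableFun.Build _ _ _ _ reflectZ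
  measurable_reflectZ.

End translations.
Arguments reflectR {R}.

Section mixture.
Context d (Z : measurableType d) (R : realType).
Variables (p : {i01 R}) (P0 P1 : probability Z R).
Local Open Scope ereal_scope.

Definition mixture : set Z -> \bar R :=
  measure_add (mscale (p%:num%:nng)%R P0) (mscale ((1 - p%:num)%:nng)%R P1).

HB.instance Definition _ := Measure.on mixture.

Lemma mixtureE A : mixture A = p%:num%:E * P0 A + (1 - p%:num)%R%:E * P1 A.
Proof. by rewrite /mixture measure_addE. Qed.

Let mixture_setT : mixture setT = 1.
Proof. by rewrite mixtureE !probability_setT !mule1 -EFinD subrKC. Qed.

HB.instance Definition _ := Measure_isProbability.Build _ _ _ mixture
  mixture_setT.

End mixture.

Section renyi.
Context d (Z : measurableType d) (R : realType).
Implicit Types (P Q : probability Z R) (alpha : R).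
Local Open Scope ereal_scope.
Local Open Scope charge_scope.

Definition renyi_moment alpha P Q : \bar R :=
  if `[< P `<< Q >] then
    \int[P]_x poweR (('d (charge_of_finite_measure P) '/d Q) x) (alpha - 1)
  else +oo.

Definition renyi_divergence alpha P Q : \bar R :=
  (alpha - 1)^-1%:E * lne (renyi_moment alpha P Q).

(* Intended for tr := translateR, opp := reflectR when Z is R, and for
   tr := translateZ, opp := reflectZ when Z is int. *)
Variables (tr : Z -> {mfun Z >-> Z}) (opp : {mfun Z >-> Z}).

Definition shift_law (t : Z) P : probability Z R := distribution P (tr t).

Definition symmetric_law P : Prop :=
  forall A, measurable A -> distribution P opp A = P A.

Definition renyi_g alpha P (t : Z) : \bar R :=
  renyi_moment alpha P (shift_law t P).

Definition renyi_gmax alpha (S : set Z) P : \bar R :=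
  ereal_sup [set renyi_g alpha P t | t in S].

Definition objective alpha (S : set Z) P : \bar R :=
  ereal_sup [set renyi_divergence alpha P (shift_law t P) | t in S].

Definition feasible (c : Z -> R) (C : R) : set (probability Z R) :=
  [set P | 'E_P[c] <= C%:E].

End renyi.

Section minimization.
Context (R : realType) (T : Type).
Local Open Scope ereal_scope.

Definition optimal_value (f : T -> \bar R) (F : set T) : \bar R :=
  ereal_inf (f @` F).

Definition is_minimizer (f : T -> \bar R) (F : set T) (x : T) : Prop :=
  F x /\ forall y, F y -> f x <= f y.

End minimization.

(* Main.v *)
(* If h is a density of P with respect to Q, the moment of (P, Q) is the integral
   of h^alpha against Q. Given a mixture Q = p Q0 + (1-p) Q1, let w_i be the
   density of Q_i with respect to Q, so that p w0 + (1-p) w1 = 1 almost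
   everywhere. If h_i is a density of P_i with respect to Q_i, then
   p w0 h0 + (1-p) w1 h1 is a density of p P0 + (1-p) P1 with respect to Q, and
   pointwise convexity of x^alpha integrates to joint convexity of the moment.
   For (ii), average P with its reflection P': the reflection preserves cost and
   turns the shift by t into the shift by -t, so by convexity the g_t of the
   average is at most max(g_t(P), g_{-t}(P)), and log is monotone. *)
Require Import Defs.
From HB Require Import structures.
From mathcomp Require Import all_boot all_order all_algebra.
From mathcomp Require Import all_classical all_reals all_analysis.
From mathcomp Require Import measurable_realfun.
From mathcomp Require Import lra.

Set Implicit Arguments.
Unset Strict Implicit.
Unset Printing Implicit Defensive.

Import Order.TTheory GRing.Theory Num.Theory.

Local Open Scope classical_set_scope.
Local Open Scope ring_scope.

(** * Densities and joint convexity of the moment *)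

Section density.
Context d (T : measurableType d) (R : realType).
Implicit Types (P Q : probability T R) (h : T -> R).
Local Open Scope ereal_scope.
Local Open Scope charge_scope.

(** A density is a real-valued representative, nonnegative at every point, so that real powers and
    products of densities can be formed pointwise. *)
Definition is_density P Q h : Prop :=
  [/\ measurable_fun setT h, forall x, (0 <= h x)%R &
      forall A, measurable A -> P A = \int[Q]_(x in A) (h x)%:E].

Lemma density_exists P Q : P `<< Q -> exists h, is_density P Q h.
Proof.
move=> PQ; pose f := Radon_Nikodym_SigmaFinite.f P Q.
(* This representative of the Radon-Nikodym derivative is finite everywhere, so [fine] changes no
   value. *)
have fE x : (fine (f x))%:E = f x.
  by rewrite fineK// Radon_Nikodym_SigmaFinite.f_fin_num.
exists (fine \o f); split.
- apply: measurableT_comp => //; apply: measurable_int.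
  exact: Radon_Nikodym_SigmaFinite.f_integrable.
- by move=> x; rewrite fine_ge0// Radon_Nikodym_SigmaFinite.f_ge0.
- move=> A mA; under eq_integral do rewrite /= fE.
  exact: Radon_Nikodym_SigmaFinite.f_integral.
Qed.

Lemma density_dominates P Q h : is_density P Q h -> P `<< Q.
Proof.
move=> [mh h0 hE]; apply/null_content_dominatesP => A mA QA.
rewrite hE//; apply: null_set_integral => //.
by apply/measurable_EFinP; exact: measurable_funTS.
Qed.

Lemma density_integrable P Q h : is_density P Q h ->
  Q.-integrable setT (EFin \o h).
Proof.
move=> [mh h0 hE]; apply/integrableP; split; first exact/measurable_EFinP.
under eq_integral do rewrite /= ger0_norm//.
by rewrite -hE// probability_setT ltry.
Qed.

Lemma density_ae_unique P Q h (f : T -> \bar R) : is_density P Q h ->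
    measurable_fun setT f ->
    (forall A, measurable A -> P A = \int[Q]_(x in A) f x) ->
  ae_eq Q setT (EFin \o h) f.
Proof.
move=> hd mf fE; apply: integral_ae_eq => //.
  exact: density_integrable hd.
by move=> A _ mA; case: hd => _ _ hE; rewrite -fE// -hE.
Qed.

Lemma density_ae_RN P Q h : is_density P Q h ->
  ae_eq Q setT (EFin \o h) (Radon_Nikodym_SigmaFinite.f P Q).
Proof.
move=> hd; have PQ := density_dominates hd; apply: density_ae_unique hd _ _.
  exact: measurable_int (Radon_Nikodym_SigmaFinite.f_integrable PQ).
by move=> A mA; exact: Radon_Nikodym_SigmaFinite.f_integral.
Qed.

Lemma density_change_of_variables P Q h (f : T -> \bar R) A :
    is_density P Q h -> (forall x, 0 <= f x) -> measurable A ->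
    measurable_fun A f ->
  \int[P]_(x in A) f x = \int[Q]_(x in A) (f x * (h x)%:E).
Proof.
move=> hd f0 mA mf; have PQ := density_dominates hd.
rewrite -(Radon_Nikodym_SigmaFinite.change_of_variables PQ)//.
have mRN := measurable_int _ (Radon_Nikodym_SigmaFinite.f_integrable PQ).
apply: ae_eq_integral => //.
- by apply: emeasurable_funM => //; exact: measurable_funTS.
- apply: emeasurable_funM => //; apply/measurable_EFinP/measurable_funTS.
  by case: hd.
- have /ae_eq_sym H := density_ae_RN hd.
  by apply: ae_eqe_mul2l; apply: ae_eq_subset H.
Qed.

(** Passing from [P] to [Q] brings in one more factor [h], which raises the exponent from
    [alpha - 1] to [alpha]; any representative may serve as [h]. *)
Lemma renyi_moment_density alpha P Q h : (1 < alpha)%R -> is_density P Q h ->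
  renyi_moment alpha P Q = \int[Q]_x (h x `^ alpha)%:E.
Proof.
move=> a1 hd; have PQ := density_dominates hd.
rewrite /renyi_moment ifT; last exact/asboolP.
have mRN : measurable_fun setT ('d (charge_of_finite_measure P) '/d Q).
  by apply: measurable_int; exact: Radon_Nikodym_integrable.
have [mh h0 hE] := hd.
rewrite (density_change_of_variables hd)//; last 2 first.
- by move=> x; exact: poweR_ge0.
- exact: (measurableT_comp (measurable_poweR _)).
apply: ae_eq_integral => //.
- apply: emeasurable_funM; last exact/measurable_EFinP.
  exact: (measurableT_comp (measurable_poweR _)).
- by apply/measurable_EFinP; apply: (measurableT_comp (measurable_powR _)).
have RNE := density_ae_unique hd mRN (fun A =>
  @Radon_Nikodym_integral _ _ _ (charge_of_finite_measure P) Q A PQ).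
apply: filterS RNE => x /= /(_ Logic.I) <- _.
(* The density may vanish at [x], so splitting the exponent rests on [alpha] being nonzero. *)
rewrite poweR_EFin -EFinM -[in RHS](subrK 1%R alpha) [in RHS]powRD ?powRr1//.
by rewrite subrK gt_eqF// (lt_trans _ a1).
Qed.

(** Both sides are densities of [Q] with respect to itself, and densities are unique almost
    everywhere. *)
Lemma ae_density_conv (p q : R) Q Q0 Q1 w0 w1 : (0 <= p)%R -> (0 <= q)%R ->
    (forall A, measurable A -> Q A = p%:E * Q0 A + q%:E * Q1 A) ->
    is_density Q0 Q w0 -> is_density Q1 Q w1 ->
  ae_eq Q setT (fun x => (p * w0 x + q * w1 x)%:E) (cst 1).
Proof.
move=> p0 q0 QE [mw0 w00 w0E] [mw1 w10 w1E].
have Qd : is_density Q Q (fun x => p * w0 x + q * w1 x)%R.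
  split.
  - by apply: measurable_funD; exact: measurable_funM.
  - by move=> x; rewrite addr_ge0// mulr_ge0.
  - move=> A mA; rewrite QE// w0E// w1E//.
    have mw0A : measurable_fun A (EFin \o w0).
      by apply/measurable_EFinP; exact: measurable_funTS.
    have mw1A : measurable_fun A (EFin \o w1).
      by apply/measurable_EFinP; exact: measurable_funTS.
    rewrite -!ge0_integralZl//; try by move=> x _; rewrite lee_fin.
    rewrite -ge0_integralD//; try by move=> x _; rewrite lee_fin mulr_ge0.
    - by apply: emeasurable_funM.
    - by apply: emeasurable_funM.
apply: (density_ae_unique Qd) => //.
by move=> A mA; rewrite integral_cst// mul1e.
Qed.

(** Chain rule: [h0 * w0] and [h1 * w1] are the densities of [P0] and [P1] with respect to [Q]; the
    rest is linearity of the integral. *)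
Lemma is_density_conv (p q : R) P P0 P1 Q Q0 Q1 h0 h1 w0 w1 :
    (0 <= p)%R -> (0 <= q)%R ->
    (forall A, measurable A -> P A = p%:E * P0 A + q%:E * P1 A) ->
    is_density P0 Q0 h0 -> is_density P1 Q1 h1 ->
    is_density Q0 Q w0 -> is_density Q1 Q w1 ->
  is_density P Q (fun x => p * (h0 x * w0 x) + q * (h1 x * w1 x))%R.
Proof.
move=> p0 q0 PE [mh0 h00 h0E] [mh1 h10 h1E] dw0 dw1.
have [mw0 w00 _] := dw0; have [mw1 w10 _] := dw1.
split.
- by apply: measurable_funD; do 2 apply: measurable_funM => //.
- by move=> x; rewrite addr_ge0// !mulr_ge0.
- move=> A mA; rewrite PE// h0E// h1E//.
  have mE (f : T -> R) : measurable_fun setT f -> measurable_fun A (EFin \o f).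
    by move=> mf; apply/measurable_EFinP; exact: measurable_funTS.
  rewrite (density_change_of_variables dw0 (f := EFin \o h0))//; last exact: (mE _ mh0).
  rewrite (density_change_of_variables dw1 (f := EFin \o h1))//; last exact: (mE _ mh1).
  rewrite -!ge0_integralZl//.
  + rewrite -ge0_integralD//.
    * by move=> x _; rewrite lee_fin !mulr_ge0.
    * apply: emeasurable_funM => //; apply: emeasurable_funM; exact: mE.
    * by move=> x _; rewrite lee_fin !mulr_ge0.
    * apply: emeasurable_funM => //; apply: emeasurable_funM; exact: mE.
  + apply: emeasurable_funM; exact: mE.
  + by move=> x _; rewrite lee_fin mulr_ge0.
  + apply: emeasurable_funM; exact: mE.
  + by move=> x _; rewrite lee_fin mulr_ge0.
Qed.

Lemma renyi_moment_ge0 alpha P Q : 0 <= renyi_moment alpha P Q.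
Proof.
rewrite /renyi_moment; case: ifP => // _.
by apply: integral_ge0 => x _; exact: poweR_ge0.
Qed.

(** Both weights are positive, so a null set of [Q] annihilates each of the two nonnegative
    terms. *)
Lemma dominates_conv (p : R) Q Q0 Q1 : (0 < p < 1)%R ->
    (forall A, measurable A -> Q A = p%:E * Q0 A + (1 - p)%:E * Q1 A) ->
  Q0 `<< Q /\ Q1 `<< Q.
Proof.
move=> /andP[p0 p1] QE; have q0 : (0 < 1 - p)%R by rewrite subr_gt0.
split; apply/null_content_dominatesP => A mA QA0; move/esym/eqP: (QE A mA);
  rewrite [Q A]QA0 padde_eq0 ?mule_ge0 ?measure_ge0 ?lee_fin ?(ltW p0) ?(ltW q0)//;
  rewrite !mule_eq0 !eqe (gt_eqF p0) (gt_eqF q0)/=.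
  by move=> /andP[/eqP].
by move=> /andP[_ /eqP].
Qed.

Lemma powR_conv_le (alpha a b x y : R) : (1 <= alpha)%R ->
  (0 <= a)%R -> (0 <= b)%R -> (a + b = 1)%R -> (0 <= x)%R -> (0 <= y)%R ->
  ((a * x + b * y) `^ alpha <= a * x `^ alpha + b * y `^ alpha)%R.
Proof.
move=> a1 a0 b0 ab x0 y0.
have a01 : (0 <= a <= 1)%R by rewrite a0/= -ab lerDl.
have := @convex_powR R alpha a1 (Itv01 a0 (proj2 (andP a01))) x y.
rewrite !inE/= !in_itv/= !andbT => /(_ x0 y0).
have -> : b = (1 - a)%R by rewrite -ab addrAC subrr add0r.
by rewrite !convRE.
Qed.

(** The weights are kept positive so that an infinite moment makes the right side infinite and [Q]
    dominates both components. *)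
Lemma renyi_moment_conv_open alpha (p : R) P P0 P1 Q Q0 Q1 :
    (1 < alpha)%R -> (0 < p < 1)%R ->
    (forall A, measurable A -> P A = p%:E * P0 A + (1 - p)%:E * P1 A) ->
    (forall A, measurable A -> Q A = p%:E * Q0 A + (1 - p)%:E * Q1 A) ->
  renyi_moment alpha P Q <=
    p%:E * renyi_moment alpha P0 Q0 + (1 - p)%:E * renyi_moment alpha P1 Q1.
Proof.
move=> a1 p01 PE QE; have /andP[p0 p1] := p01.
have q0 : (0 < 1 - p)%R by rewrite subr_gt0.
(* Without domination the moment is [+oo]; the other term is nonnegative, so the sum is [+oo] and
   the bound is trivial. *)
have [PQ0|PQ0] := pselect (P0 `<< Q0); last first.
  rewrite [renyi_moment alpha P0 Q0]/renyi_moment ifF; last exact/asboolPn.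
  rewrite gt0_muley ?lte_fin// addye ?leey// -ltNye.
  by rewrite (lt_le_trans ltNy0)// mule_ge0 ?renyi_moment_ge0// lee_fin ltW.
have [PQ1|PQ1] := pselect (P1 `<< Q1); last first.
  rewrite [renyi_moment alpha P1 Q1]/renyi_moment ifF; last exact/asboolPn.
  rewrite gt0_muley ?lte_fin// addey ?leey// -ltNye.
  by rewrite (lt_le_trans ltNy0)// mule_ge0 ?renyi_moment_ge0// lee_fin ltW.
have [Q0Q Q1Q] := dominates_conv p01 QE.
have [h0 dh0] := density_exists PQ0; have [h1 dh1] := density_exists PQ1.
have [w0 dw0] := density_exists Q0Q; have [w1 dw1] := density_exists Q1Q.
have dk := is_density_conv (ltW p0) (ltW q0) PE dh0 dh1 dw0 dw1.
rewrite (renyi_moment_density a1 dk) (renyi_moment_density a1 dh0).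
rewrite (renyi_moment_density a1 dh1).
have [mh0 h00 _] := dh0; have [mh1 h10 _] := dh1.
have [mw0 w00 _] := dw0; have [mw1 w10 _] := dw1.
have mha0 := measurableT_comp (measurable_powR alpha) mh0.
have mha1 := measurableT_comp (measurable_powR alpha) mh1.
(* All integrals are moved to the common measure [Q], where the integrands can be compared
   pointwise. *)
rewrite (density_change_of_variables dw0)//; last 2 first.
- by move=> x; rewrite lee_fin powR_ge0.
- exact/measurable_EFinP.
rewrite (density_change_of_variables dw1)//; last 2 first.
- by move=> x; rewrite lee_fin powR_ge0.
- exact/measurable_EFinP.
have mhw0 : measurable_fun setT (fun x => (h0 x `^ alpha)%:E * (w0 x)%:E).
  by apply: emeasurable_funM; exact/measurable_EFinP.
have mhw1 : measurable_fun setT (fun x => (h1 x `^ alpha)%:E * (w1 x)%:E).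
  by apply: emeasurable_funM; exact/measurable_EFinP.
have hw0 x : 0 <= (h0 x `^ alpha)%:E * (w0 x)%:E.
  by rewrite lee_fin mulr_ge0// powR_ge0.
have hw1 x : 0 <= (h1 x `^ alpha)%:E * (w1 x)%:E.
  by rewrite lee_fin mulr_ge0// powR_ge0.
rewrite -!ge0_integralZl ?lee_fin ?(ltW p0) ?(ltW q0)//.
rewrite -ge0_integralD//; last 4 first.
- by move=> x _; rewrite mule_ge0// lee_fin ltW.
- exact: emeasurable_funM.
- by move=> x _; rewrite mule_ge0// lee_fin ltW.
- exact: emeasurable_funM.
apply: ae_ge0_le_integral => //.
- by move=> x _; rewrite lee_fin powR_ge0.
- apply/measurable_EFinP; apply: (measurableT_comp (measurable_powR alpha)).
  by case: dk.
- by move=> x _; rewrite adde_ge0// mule_ge0// lee_fin ltW.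
- by apply: emeasurable_funD; exact: emeasurable_funM.
have w1ae := ae_density_conv (ltW p0) (ltW q0) QE dw0 dw1.
apply: filterS w1ae => x /= /(_ Logic.I) -[w1E] _.
rewrite -!EFinM -EFinD lee_fin.
have swap (a b c : R) : (a * (b * c) = a * c * b)%R by rewrite mulrA mulrAC.
(* After regrouping, [p * w0 x] and [(1 - p) * w1 x] are the convex weights, with sum 1 by [w1E],
   and [h0 x], [h1 x] are the points. *)
rewrite !swap; apply: (powR_conv_le (ltW a1)) => //; apply: mulr_ge0 => //.
- exact: ltW.
- exact: ltW.
Qed.

(** If [h] is a density of [P] with respect to [Q], then [h \o psi] is one of [P'] with respect to
    [Q'], as [psi] is its own inverse. *)
Lemma renyi_moment_involution alpha P P' Q Q' (psi : {mfun T >-> T}) :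
    (1 < alpha)%R -> involutive psi ->
    (forall A, measurable A -> P' A = P (psi @^-1` A)) ->
    (forall A, measurable A -> Q' A = Q (psi @^-1` A)) ->
  renyi_moment alpha P' Q' = renyi_moment alpha P Q.
Proof.
move=> a1 psiK PE QE.
have mpre A : measurable A -> measurable (psi @^-1` A).
  by move=> mA; exact: measurable_funPTI.
have psi2 A : psi @^-1` (psi @^-1` A) = A.
  by apply/seteqP; split => x /=; rewrite psiK.
have [PQ|PQ] := pselect (P `<< Q); last first.
  (* [P] and [Q] are in turn the images of [P'] and [Q'], so domination fails for both pairs and
     both moments are [+oo]. *)
  rewrite /renyi_moment !ifF//; apply/asboolPn => //.
  apply: contra_not PQ => /null_content_dominatesP PQ'.
  apply/null_content_dominatesP => A mA QA.
  have := PE _ (mpre _ mA); rewrite psi2 => <-.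
  apply: PQ'; first exact: mpre.
  by have := QE _ (mpre _ mA); rewrite psi2 => QE'; exact: etrans QA.
have [h dh] := density_exists PQ; have [mh h0 hE] := dh.
have chv f A : measurable A -> measurable_fun setT f -> (forall x, 0 <= f x) ->
    \int[Q']_(x in A) f (psi x) = \int[Q]_(x in psi @^-1` A) f x.
  move=> mA mf f0.
  rewrite (@eq_measure_integral _ _ _ _ (pushforward Q psi))//; last first.
    by move=> B mB _; exact: QE.
  rewrite ge0_integral_pushforward//.
    by apply: eq_integral => x _ /=; rewrite psiK.
  by apply: measurable_funTS; exact: measurableT_comp.
have dh' : is_density P' Q' (h \o psi).
  split; [exact: measurableT_comp | by move=> x; exact: h0 | move=> A mA].
  rewrite (chv (EFin \o h))//; last exact/measurable_EFinP.
  by rewrite PE// hE//; exact: mpre.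
rewrite (renyi_moment_density a1 dh') (renyi_moment_density a1 dh).
rewrite (chv (fun x => (h x `^ alpha)%:E)) ?preimage_setT//.
- apply/measurable_EFinP; exact: (measurableT_comp (measurable_powR alpha)).
- by move=> x; rewrite lee_fin powR_ge0.
Qed.

End density.

(** * Convexity for all weights, and for the supremum over shifts *)

Section convexity.
Context d (T : measurableType d) (R : realType).
Implicit Types (P Q : probability T R).
Local Open Scope ereal_scope.

(** Agreement on measurable sets does not make two measures equal as set functions; the involution
    lemma at the identity gives equal moments all the same. *)
Lemma renyi_moment_eq alpha P P' Q Q' : (1 < alpha)%R ->
    (forall A, measurable A -> P' A = P A) ->
    (forall A, measurable A -> Q' A = Q A) ->
  renyi_moment alpha P' Q' = renyi_moment alpha P Q.
Proof.
move=> a1 PE QE.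
pose i : {mfun T >-> T} :=
  HB.pack (@idfun T) (isMeasurableFun.Build _ _ _ _ (@idfun T) (@measurable_id _ T setT)).
exact: (@renyi_moment_involution _ _ _ _ _ _ _ _ i).
Qed.

(** At the endpoints the convention that 0 times [+oo] is 0 leaves a single moment, and the mixtures
    agree with that component. *)
Lemma renyi_moment_conv alpha (p : {i01 R}) P P0 P1 Q Q0 Q1 :
    (1 < alpha)%R ->
    (forall A, measurable A -> P A = p%:num%:E * P0 A + (1 - p%:num)%:E * P1 A) ->
    (forall A, measurable A -> Q A = p%:num%:E * Q0 A + (1 - p%:num)%:E * Q1 A) ->
  renyi_moment alpha P Q <= p%:num%:E * renyi_moment alpha P0 Q0 +
                            (1 - p%:num)%:E * renyi_moment alpha P1 Q1.
Proof.
move=> a1 PE QE.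
have [p0|p0] := eqVneq p%:num 0%R.
  rewrite p0 subr0 mul0e mul1e add0e.
  rewrite (@renyi_moment_eq alpha P1 P Q1 Q)// => A mA.
    by rewrite PE// p0 subr0 mul0e mul1e add0e.
  by rewrite QE// p0 subr0 mul0e mul1e add0e.
have [p1|p1] := eqVneq p%:num 1%R.
  rewrite p1 subrr mul0e mul1e adde0.
  rewrite (@renyi_moment_eq alpha P0 P Q0 Q)// => A mA.
    by rewrite PE// p1 subrr mul0e mul1e adde0.
  by rewrite QE// p1 subrr mul0e mul1e adde0.
apply: renyi_moment_conv_open => //.
by rewrite !lt_neqAle eq_sym p0 p1 ge0 le1.
Qed.

Variable tr : T -> {mfun T >-> T}.

(** Shifting commutes with mixing, so joint convexity applies to the pair of a law and its shift. *)
Lemma renyi_g_conv alpha (p : {i01 R}) P0 P1 t : (1 < alpha)%R ->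
  renyi_g tr alpha (mixture p P0 P1) t <=
    p%:num%:E * renyi_g tr alpha P0 t + (1 - p%:num)%:E * renyi_g tr alpha P1 t.
Proof.
by move=> a1; apply: renyi_moment_conv => // A mA; exact: mixtureE.
Qed.

Lemma renyi_gmax_conv alpha (S : set T) (p : {i01 R}) P0 P1 : (1 < alpha)%R ->
  renyi_gmax tr alpha S (mixture p P0 P1) <=
    p%:num%:E * renyi_gmax tr alpha S P0 +
    (1 - p%:num)%:E * renyi_gmax tr alpha S P1.
Proof.
move=> a1; apply: ge_ereal_sup => _ [t St <-].
apply: (le_trans (renyi_g_conv _ _ _ _ a1)); apply: leeD.
- by apply: lee_wpmul2l; [rewrite lee_fin | apply: ereal_sup_ubound; exists t].
- apply: lee_wpmul2l; first by rewrite lee_fin subr_ge0.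
  by apply: ereal_sup_ubound; exists t.
Qed.

End convexity.

(** * Averaging a law with its reflection, for an abstract involution *)

Section symmetrization.
Context d (T : measurableType d) (R : realType).
Variables (tr : T -> {mfun T >-> T}) (opp : {mfun T >-> T}).
Hypothesis oppK : involutive opp.
Hypothesis opp_tr : forall t x, opp (tr t x) = tr (opp t) (opp x).
Implicit Types (P Q : probability T R).
Local Open Scope ereal_scope.

Let half_ge0 : (0 <= 2^-1 :> R)%R. Proof. by rewrite invr_ge0. Qed.
Let half_le1 : (2^-1 <= 1 :> R)%R. Proof. by rewrite invf_le1// ler1n. Qed.
Let half01 : {i01 R} := Itv01 half_ge0 half_le1.

Definition symmetrize P : probability T R :=
  mixture half01 P (distribution P opp).

Lemma symmetrizeE P A :
  symmetrize P A = 2^-1%:E * P A + 2^-1%:E * P (opp @^-1` A).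
Proof.
rewrite [LHS]mixtureE; congr (_ + _%:E * _).
by rewrite /=; lra.
Qed.

Lemma symmetrize_symmetric P : symmetric_law opp (symmetrize P).
Proof.
move=> A mA; rewrite /distribution/= /pushforward !symmetrizeE addeC.
congr (_ * P _ + _); apply/seteqP; split => x /=; by rewrite oppK.
Qed.

Lemma expectation_symmetrize P (c : T -> R) : measurable_fun setT c ->
    (forall x, (0 <= c x)%R) -> (forall x, c (opp x) = c x) ->
  'E_(symmetrize P)[c] = 'E_P[c].
Proof.
move=> mc c0 copp; rewrite !unlock.
have mcE : measurable_fun setT (EFin \o c) by exact/measurable_EFinP.
have c0E x : [set: T] x -> 0 <= (EFin \o c) x by move=> _; rewrite lee_fin.
rewrite ge0_integral_measure_add//= !ge0_integral_mscale//=.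
rewrite ge0_integral_pushforward//; last by move=> x _; rewrite lee_fin.
rewrite preimage_setT; under [X in _ + _ * X]eq_integral do rewrite /= copp.
rewrite -ge0_muleDl ?lee_fin//; last by lra.
by rewrite -EFinD [X in X%:E](_ : _ = 1%R) ?mul1e//; lra.
Qed.

(** Reflecting and then shifting by [t] is shifting by [opp t] and then reflecting, so both laws in
    the moment are reflected images. *)
Lemma renyi_g_reflect alpha P t : (1 < alpha)%R ->
  renyi_g tr alpha (distribution P opp) t = renyi_g tr alpha P (opp t).
Proof.
move=> a1; apply: (renyi_moment_involution a1 oppK) => // A mA.
congr (P _); apply/seteqP; split => x /=; by rewrite opp_tr oppK.
Qed.

(** The average given by convexity is weakened to a maximum, which passes through the logarithm by
    monotonicity alone. *)
Lemma renyi_g_symmetrize alpha P t : (1 < alpha)%R ->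
  renyi_g tr alpha (symmetrize P) t <=
    maxe (renyi_g tr alpha P t) (renyi_g tr alpha P (opp t)).
Proof.
move=> a1; apply: (le_trans (renyi_g_conv _ _ _ _ _ a1)).
rewrite renyi_g_reflect//.
set m := maxe _ _.
have m0 : 0 <= m by rewrite le_max renyi_moment_ge0.
apply: (@le_trans _ _ (2^-1%:E * m + 2^-1%:E * m)).
  apply: leeD.
    by apply: lee_wpmul2l; rewrite ?lee_fin// le_max lexx.
  rewrite [X in X%:E * _](_ : _ = 2^-1)%R; last by rewrite /=; lra.
  by apply: lee_wpmul2l; rewrite ?lee_fin// le_max lexx orbT.
rewrite -ge0_muleDl ?lee_fin//.
by rewrite -EFinD [X in X%:E](_ : _ = 1%R) ?mul1e//; lra.
Qed.

Lemma renyi_divergence_mono alpha P Q P' Q' : (1 < alpha)%R ->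
  renyi_moment alpha P Q <= renyi_moment alpha P' Q' ->
  renyi_divergence alpha P Q <= renyi_divergence alpha P' Q'.
Proof.
move=> a1 le_m; apply: lee_wpmul2l.
  by rewrite lee_fin invr_ge0 subr_ge0 ltW.
by rewrite lee_lne// in_itv/= leey renyi_moment_ge0.
Qed.

Variables (alpha : R) (S : set T).
Hypothesis alpha1 : (1 < alpha)%R.
Hypothesis Sopp : forall t, S t -> S (opp t).

(** As [S] is stable under [opp], both entries of the maximum come from shifts that compete in the
    supremum for [P]. *)
Lemma objective_symmetrize P :
  objective tr alpha S (symmetrize P) <= objective tr alpha S P.
Proof.
apply: ge_ereal_sup => _ [t St <-].
have := renyi_g_symmetrize P t alpha1; rewrite le_max => /orP[] le_g.
- apply: (le_trans (renyi_divergence_mono alpha1 le_g)).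
  by apply: ereal_sup_ubound; exists t.
- apply: (le_trans (renyi_divergence_mono alpha1 le_g)).
  by apply: ereal_sup_ubound; exists (opp t) => //; exact: Sopp.
Qed.

Variables (c : T -> R) (C : R).
Hypothesis mc : measurable_fun setT c.
Hypothesis c0 : forall x, (0 <= c x)%R.
Hypothesis copp : forall x, c (opp x) = c x.

Let f := @objective _ _ R tr alpha S.
Let F := @feasible _ _ R c C.

Lemma feasible_symmetrize P : F P -> F (symmetrize P).
Proof. by rewrite /F /feasible/= expectation_symmetrize. Qed.

Lemma optimal_value_symmetric :
  optimal_value f F = optimal_value f [set P | F P /\ symmetric_law opp P].
Proof.
apply/eqP; rewrite eq_le; apply/andP; split.
  by apply: ereal_inf_le_tmp => _ [P [FP _] <-]; exists P.
(* For the other inequality, each feasible law is replaced by its symmetrization, feasible with no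
   larger objective. *)
apply: le_ereal_inf_tmp => _ [P FP <-].
apply: (le_trans _ (objective_symmetrize P)); apply: ereal_inf_lbound.
exists (symmetrize P) => //; split; first exact: feasible_symmetrize.
exact: symmetrize_symmetric.
Qed.

Lemma symmetric_minimizer : (exists P, is_minimizer f F P) ->
  exists P, is_minimizer f F P /\ symmetric_law opp P.
Proof.
move=> [P [FP minP]]; exists (symmetrize P); split.
  split; first exact: feasible_symmetrize.
  by move=> Q FQ; apply: (le_trans (objective_symmetrize P)); exact: minP.
exact: symmetrize_symmetric.
Qed.

End symmetrization.

(** * Specialization to the real line and to the integers *)

Theorem theorem3p1 (R : realType) (alpha : R) (halpha : 1 < alpha) :
  (* over the reals *)
  (forall (s : R) (c : R -> R) (C : R),
      0 < s -> measurable_fun [set: R] c ->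
      (forall z, 0 <= c z) -> (forall z, c (- z) = c z) -> 0 < C ->
    let S : set R := `[- s, s]%classic in
    let g := renyi_gmax (@translateR R) alpha S in
    let f := objective (@translateR R) alpha S in
    let F := feasible c C in
    [/\ forall (p : {i01 R}) (P0 P1 : probability R R),
          (g (mixture p P0 P1) <=
             p%:num%:E * g P0 + (1 - p%:num)%R%:E * g P1)%E,
        optimal_value f F = optimal_value f [set P | F P /\ symmetric_law reflectR P]
      & (exists P, is_minimizer f F P) ->
        exists P, is_minimizer f F P /\ symmetric_law reflectR P])
  /\
  (* over the integers *)
  (forall (s : int) (c : int -> R) (C : R),
      0 < s ->
      (forall z, 0 <= c z) -> (forall z, c (- z) = c z) -> 0 < C ->
    let S : set int := `[- s, s]%classic in
    let g := renyi_gmax translateZ alpha S in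
    let f := objective translateZ alpha S in
    let F := feasible c C in
    [/\ forall (p : {i01 R}) (P0 P1 : probability int R),
          (g (mixture p P0 P1) <=
             p%:num%:E * g P0 + (1 - p%:num)%R%:E * g P1)%E,
        optimal_value f F = optimal_value f [set P | F P /\ symmetric_law reflectZ P]
      & (exists P, is_minimizer f F P) ->
        exists P, is_minimizer f F P /\ symmetric_law reflectZ P]).
Proof.
split=> [s c C s0 mc c0 cN C0 | s c C s0 c0 cN C0] S g f F.
- have SN t : S t -> S (reflectR t).
    by rewrite /S /reflectR /= !in_itv/= => /andP[st ts]; rewrite lerN2 ts lerNl st.
  have trN (t x : R) :
      reflectR (translateR t x) = translateR (reflectR t) (reflectR x).
    exact: opprD.
  have oppK : involutive (@reflectR R) by exact: opprK.
  split=> [p P0 P1||].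
  + exact: renyi_gmax_conv.
  + exact: optimal_value_symmetric.
  + exact: symmetric_minimizer.
- have SN t : S t -> S (reflectZ t).
    by rewrite /S /reflectZ /= !in_itv/= => /andP[st ts]; rewrite lerN2 ts lerNl st.
  have trN (t x : int) :
      reflectZ (translateZ t x) = translateZ (reflectZ t) (reflectZ x).
    exact: opprD.
  have oppK : involutive reflectZ by exact: opprK.
  (* The integers carry the discrete sigma-algebra, so every cost is measurable. *)
  have mc : measurable_fun [set: int] c by [].
  split=> [p P0 P1||].
  + exact: renyi_gmax_conv.
  + exact: optimal_value_symmetric.
  + exact: symmetric_minimizer.
Qed.
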